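(* Let $f(X)=a_{0}+a_{1}X+\cdots +a_{n}X^{n}\in \mathbb{Z}[X]$, $a_{0}a_{n}\neq 0$. Suppose there exist two distinct prime numbers $p$ and $q$ and an index $j\geq 1$ with $j<\frac{n}{\gcd(\nu _{q}(a_{n}),n)}$ such that (i) $\nu _{p}(a_{0}) = 0$; $\frac{\nu _{p}(a_{i})}{i} > \frac{\nu _{p}(a_{j})}{j}$ for $0<i<j$; $\nu _{p}(a_{j})>0$; $\nu _{p}(a_{i}) > \frac{n-i}{n-j}\, \nu _{p}(a_{j})+\frac{i-j}{n-j}\, \nu _{p}(a_{n})$ for $j<i<n$; and $\frac{\nu _{p}(a_{n})}{n}>\frac{\nu _{p}(a_{j})}{j}$; (ii) $\nu _{q}(a_{0})=0$, $\frac{\nu _{q}(a_{i})}{i}\geq\frac{\nu _{q}(a_{n})}{n}$ for all $0<i\le n$, and $\nu _{q}(a_{n})>0$; (iii) $\gcd(\nu _{p}(a_{j}),j)=\gcd(\nu _{p}(a_{n})-\nu _{p}(a_{j}),n-j)=1$. Then $f$ is irreducible over $\mathbb{Q}$.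
   Context: For a prime $p$ and a nonzero integer $m$, $\nu_p(m)$ is the largest integer $i$ such that $p^i\mid m$; by convention $\nu_p(0)=\infty$ (so lower bounds on $\nu_p(a_i)$ hold automatically when $a_i=0$). The hypotheses are understood to include that $a_j\neq 0$, so that $\nu_p(a_j)$ is finite. *)

(* Defs.v *)
From mathcomp Require Import all_boot all_order all_algebra.

Set Implicit Arguments.
Unset Strict Implicit.
Unset Printing Implicit Defensive.

Import Order.TTheory GRing.Theory Num.Theory.
Local Open Scope ring_scope.

(* The p-adic valuation of a nonzero integer. At m = 0 it takes the junk value
   0 instead of infinity, so a lower bound on the valuation of a possibly zero
   m must be guarded by m != 0. *)
Definition padic_val (p : nat) (m : int) : nat := logn p `|m|%N.

(* Main.v *)
Require Import Defs.
From mathcomp Require Import all_boot all_order all_algebra.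
From mathcomp Require Import zify.

Set Implicit Arguments.
Unset Strict Implicit.
Unset Printing Implicit Defensive.

Import Order.TTheory GRing.Theory Num.Theory.
Local Open Scope ring_scope.

(* Newton polygons with respect to q and p. By Gauss's lemma a factorization of
   f may be taken over Z, f = g h. The weight b v(c_i) - a i of the coefficient
   c_i is constant along the edge of slope a / b of a Newton polygon; the first
   index at which it is minimal is additive under products. If f has an edge of
   slope a / b that ends at its degree, then g has one (possibly reduced to a
   point) from some s to its degree d, whence b divides a (d - s). The single
   edge of the q-polygon gives n | v_q(a_n) d, so that d = 0 as soon as d <= j;
   the same holds for the degree d' of h. The last edge of the p-polygon goes
   from j to n and has no inner lattice point, so it comes entirely from one of
   the factors: d = s <= j or d' = s' <= j, and this factor is constant. *)

Lemma padic_valM (p : nat) (x y : int) : x != 0 -> y != 0 ->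
  padic_val p (x * y) = (padic_val p x + padic_val p y)%N.
Proof. by move=> x0 y0; rewrite /padic_val abszM lognM ?absz_gt0. Qed.

Lemma pfactor_dvdz (p k : nat) (x : int) : prime p -> x != 0 ->
  ((p ^ k)%N%:Z %| x)%Z = (k <= padic_val p x)%N.
Proof. by move=> pp x0; rewrite dvdzE /= pfactor_dvdn ?absz_gt0. Qed.

(** Divisibility by [p ^ k] is closed under addition and holds at 0, so it absorbs the guards. *)
Lemma padic_valD_ge (p k : nat) (x y : int) : prime p ->
  (x != 0 -> (k <= padic_val p x)%N) -> (y != 0 -> (k <= padic_val p y)%N) ->
  x + y != 0 -> (k <= padic_val p (x + y))%N.
Proof.
move=> pp hx hy xy0; rewrite -pfactor_dvdz //.
have dvd z : (z != 0 -> (k <= padic_val p z)%N) -> ((p ^ k)%N%:Z %| z)%Z.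
  by have [-> _|z0 /(_ isT)] := eqVneq z 0; rewrite ?dvdz0 // -pfactor_dvdz.
by apply: rpredD; apply: dvd.
Qed.

(** One more power of [p] than in [x] divides [y] but not [x], hence not the sum; this also makes
    the sum nonzero. *)
Lemma padic_valD_eq (p : nat) (x y : int) : prime p -> x != 0 ->
  (y != 0 -> (padic_val p x < padic_val p y)%N) ->
  x + y != 0 /\ padic_val p (x + y) = padic_val p x.
Proof.
move=> pp x0 hy.
have Nvdvd z : z != 0 -> ~~ ((p ^ (padic_val p z).+1)%N%:Z %| z)%Z.
  by move=> z0; rewrite pfactor_dvdz // ltnn.
have ydvd : ((p ^ (padic_val p x).+1)%N%:Z %| y)%Z.
  by have [->|y0] := eqVneq y 0; rewrite ?dvdz0 // pfactor_dvdz // hy.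
have Ndvd : ~~ ((p ^ (padic_val p x).+1)%N%:Z %| x + y)%Z.
  by rewrite rpredDr // Nvdvd.
have xy0 : x + y != 0 by apply: contraNneq Ndvd => ->; rewrite dvdz0.
split=> //; apply/eqP; rewrite eqn_leq leqNgt -pfactor_dvdz // Ndvd /=.
apply: padic_valD_ge => // y0; exact: ltnW (hy y0).
Qed.

(** [b] times the height at which the line of slope [a / b] through the point of index [i] meets the
    vertical axis; it can be negative. *)
Definition np_weight (p b a : nat) (g : {poly int}) (i : nat) : int :=
  (b * padic_val p g`_i)%N%:Z - (a * i)%N%:Z.

(* The summand [(i < s)%:Z] makes the minimum strict to the left of [s]. *)
Definition np_first (p b a : nat) (g : {poly int}) (s : nat) : Prop :=
  g`_s != 0 /\ forall i, g`_i != 0 ->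
    np_weight p b a g s + (i < s)%N%:Z <= np_weight p b a g i.

Lemma np_first_exists (p b a : nat) (g : {poly int}) : g != 0 ->
  exists s, np_first p b a g s.
Proof.
move=> g0; pose w := np_weight p b a g.
have lt_size i : g`_i != 0 -> (i < size g)%N.
  by rewrite ltnNge; apply: contra => /(nth_default 0) ->.
have lead0 : g`_(size g).-1 != 0 by rewrite -lead_coefE lead_coef_eq0.
have [/= m m0 mP] := @Order.TotalTheory.arg_minP _ _ 'I_(size g)
  (Ordinal (lt_size _ lead0)) (fun i : 'I__ => g`_i != 0) w lead0.
have exs : exists i, (g`_i != 0) && (w i == w m) by exists m; rewrite m0 eqxx.
case: (ex_minnP exs) => s /andP[s0 /eqP ws] smin; exists s; split=> // i i0.
have := mP (Ordinal (lt_size _ i0)) i0; rewrite /= -/(w s) -/(w i) ws.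
have := smin i; rewrite i0 /=; case: (eqVneq (w i) (w m)) => [->|ne].
  by move/(_ isT); rewrite leqNgt => /negPf ->; rewrite addr0.
(* Distinct integer weights differ by at least 1, which covers the strictness summand. *)
move=> _ le; have : w m < w i by rewrite lt_neqAle eq_sym ne.
lia.
Qed.

Lemma np_first_uniq (p b a : nat) (g : {poly int}) (s t : nat) :
  np_first p b a g s -> np_first p b a g t -> s = t.
Proof.
move=> [s0 sP] [t0 tP]; have := sP t t0; have := tP s s0.
by case: (ltngtP s t) => //=; lia.
Qed.

(** Of the products contributing to index [s + t], all but the one at [(s, t)] have first index
    below [s] or second index below [t], hence larger weight: the minimum cannot cancel. *)
Lemma np_firstM (p b a : nat) (g h : {poly int}) (s t : nat) :
  prime p -> (0 < b)%N -> np_first p b a g s -> np_first p b a h t ->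
  np_first p b a (g * h) (s + t) /\
  np_weight p b a (g * h) (s + t) = np_weight p b a g s + np_weight p b a h t.
Proof.
move=> pp b0 [s0 sP] [t0 tP].
pose W := np_weight p b a g s + np_weight p b a h t.
have term i k (E : nat) : g`_i * h`_k != 0 -> (E <= (i < s) + (k < t))%N ->
    W + E%:Z + (a * (i + k))%N%:Z <= (b * padic_val p (g`_i * h`_k)%R)%N%:Z.
  rewrite mulf_eq0 negb_or => /andP[i0 k0]; rewrite padic_valM // !mulnDr.
  have := sP i i0; have := tP k k0; rewrite /W /np_weight; lia.
have sum (I : Type) (r : seq I) (P : pred I) (F : I -> int) (T : int) :
    (forall i, P i -> F i != 0 -> T <= (b * padic_val p (F i))%N%:Z) ->
    \sum_(i <- r | P i) F i != 0 ->
    T <= (b * padic_val p (\sum_(i <- r | P i) F i)%R)%N%:Z.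
  move=> FP; elim/big_rec: _ => [/eqP//|i x Pi IH xy0].
  have [F0|F0] := eqVneq (F i) 0; first by move: xy0; rewrite F0 !add0r.
  have [x0|x0] := eqVneq x 0; first by rewrite x0 addr0; apply: FP.
  (* [T] need not be a multiple of [b], so the bound goes through the smaller valuation. *)
  have := @padic_valD_ge p (minn (padic_val p (F i)) (padic_val p x)) _ _ pp
    (fun _ => geq_minl _ _) (fun _ => geq_minr _ _) xy0.
  rewrite -(leq_pmul2l b0) minnMr; have := FP i Pi F0; have := IH x0; lia.
have vst : (b * padic_val p (g`_s * h`_t)%R)%N%:Z = W + (a * (s + t))%N%:Z.
  by rewrite padic_valM // /W /np_weight !mulnDr; lia.
have [st0 stW] : (g * h)`_(s + t) != 0 /\
    padic_val p (g * h)`_(s + t) = padic_val p (g`_s * h`_t).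
  have lt_s : (s < (s + t).+1)%N by lia.
  rewrite coefM (bigD1 (Ordinal lt_s)) //= addKn.
  apply: padic_valD_eq => //; first by rewrite mulf_neq0.
  move=> /(sum _ _ _ _ (W + 1 + (a * (s + t))%N%:Z)) H.
  suff /H : forall i : 'I_(s + t).+1, i != Ordinal lt_s ->
      g`_i * h`_(s + t - i) != 0 ->
      W + 1 + (a * (s + t))%N%:Z <=
        (b * padic_val p (g`_i * h`_(s + t - i))%R)%N%:Z.
    by rewrite -(ltn_pmul2l b0) -ltz_nat vst; apply: lt_le_trans; lia.
  move=> i; rewrite -val_eqE /= => ne F0.
  have := term i (s + t - i)%N 1%N F0; rewrite subnKC; last by have := ltn_ord i; lia.
  by apply; have := ltn_ord i; lia.
have wst : np_weight p b a (g * h) (s + t) = W.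
  by rewrite /np_weight stW vst addrK.
split=> //; split=> // k; rewrite wst /np_weight coefM lerBrDr.
apply: sum => i _ F0; have ik : (i <= k)%N by have := ltn_ord i; lia.
(* [k < s + t] forces [i < s] or [k - i < t], which gives the strictness. *)
by have := term i (k - i)%N (k < s + t)%N F0; rewrite subnKC //; apply; lia.
Qed.

(** Minimal weights and leading weights both add up under products. Their sums agree, so in each
    factor the leading weight is minimal: [a] times the distance from the first minimal index to the
    degree is then [b] times a difference of valuations. *)
Lemma np_edge_factor (p b a : nat) (g h : {poly int}) (j : nat) :
  prime p -> (0 < b)%N -> g * h != 0 -> np_first p b a (g * h) j ->
  np_weight p b a (g * h) (size (g * h)).-1 = np_weight p b a (g * h) j ->
  exists s t, [/\ (s + t = j)%N,
    (s <= (size g).-1)%N /\ (t <= (size h).-1)%N,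
    (b %| a * ((size g).-1 - s))%N & (b %| a * ((size h).-1 - t))%N].
Proof.
move=> pp b0 gh0 fj wl.
have /andP[g0 h0] : (g != 0) && (h != 0) by rewrite -negb_or -mulf_eq0.
have [s gs] := np_first_exists p b a g0.
have [t ht] := np_first_exists p b a h0.
have [fst wst] := np_firstM pp b0 gs ht.
have est := np_first_uniq fst fj.
have le_deg (u : {poly int}) i : u`_i != 0 -> (i <= (size u).-1)%N.
  move=> ui; have : (i < size u)%N; last lia.
  by rewrite ltnNge; apply: contra ui => /(nth_default 0) ->.
have lead0 (u : {poly int}) : u != 0 -> u`_(size u).-1 != 0.
  by rewrite -lead_coefE lead_coef_eq0.
have [[gs0 gsP] [ht0 htP]] := (gs, ht).
have hs := le_deg _ _ gs0; have ht' := le_deg _ _ ht0.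
have := gsP _ (lead0 _ g0); have := htP _ (lead0 _ h0).
have dvd (u : {poly int}) i : (i <= (size u).-1)%N ->
    np_weight p b a u (size u).-1 = np_weight p b a u i ->
    (b %| a * ((size u).-1 - i))%N.
  move=> le; rewrite /np_weight => e.
  rewrite -(dvdn_addl _ (dvdn_mulr (padic_val p u`_i) (dvdnn b))).
  have -> : (a * ((size u).-1 - i) + b * padic_val p u`_i
             = b * padic_val p u`_(size u).-1)%N.
    by rewrite mulnBr; have := leq_mul (leqnn a) le; lia.
  exact: dvdn_mulr.
have wM : np_weight p b a (g * h) (size (g * h)).-1 =
    np_weight p b a g (size g).-1 + np_weight p b a h (size h).-1.
  have sz : (size (g * h)).-1 = ((size g).-1 + (size h).-1)%N.
    by rewrite size_mul // (polySpred g0) (polySpred h0) addSn addnS.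
  rewrite /np_weight; have -> : padic_val p (g * h)`_(size (g * h)).-1 =
      (padic_val p g`_(size g).-1 + padic_val p h`_(size h).-1)%N.
    by rewrite -!lead_coefE lead_coefM padic_valM ?lead_coef_eq0.
  by rewrite sz !mulnDr; lia.
move: wl; rewrite wM -est wst => wl l1 l2.
by exists s, t; split=> //; apply: dvd => //; lia.
Qed.

Theorem theorem1p18 (f : {poly int}) (n p q j : nat)
  (size_f : size f = n.+1)
  (a0_neq0 : f`_0 != 0)
  (p_prime : prime p) (q_prime : prime q) (p_neq_q : p != q)
  (j_ge1 : (1 <= j)%N)
  (j_lt : j%:R < n%:R / (gcdn (padic_val q f`_n) n)%:R :> rat)
  (aj_neq0 : f`_j != 0)
  (p_a0 : padic_val p f`_0 = 0%N)
  (p_below_j : forall i : nat, (0 < i < j)%N -> f`_i != 0 ->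
     (padic_val p f`_i)%:R / i%:R > (padic_val p f`_j)%:R / j%:R :> rat)
  (p_aj : (0 < padic_val p f`_j)%N)
  (p_above_j : forall i : nat, (j < i < n)%N -> f`_i != 0 ->
     (padic_val p f`_i)%:R >
       (n%:R - i%:R) / (n%:R - j%:R) * (padic_val p f`_j)%:R
       + (i%:R - j%:R) / (n%:R - j%:R) * (padic_val p f`_n)%:R :> rat)
  (p_an : (padic_val p f`_n)%:R / n%:R > (padic_val p f`_j)%:R / j%:R :> rat)
  (q_a0 : padic_val q f`_0 = 0%N)
  (q_ai : forall i : nat, (0 < i <= n)%N -> f`_i != 0 ->
     (padic_val q f`_i)%:R / i%:R >= (padic_val q f`_n)%:R / n%:R :> rat)
  (q_an : (0 < padic_val q f`_n)%N)
  (gcd_j : gcdn (padic_val p f`_j) j = 1%N)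
  (gcd_n : gcdz ((padic_val p f`_n)%:Z - (padic_val p f`_j)%:Z)
                (n%:Z - j%:Z) = 1) :
  irreducible_poly (map_poly intr f : {poly rat}).
Proof.
have lt_jn : (j * gcdn (padic_val q f`_n) n < n)%N.
  by move: j_lt; rewrite ltr_pdivlMr ?ltr0n ?gcdn_gt0 ?q_an // -natrM ltr_nat.
have j_n : (j < n)%N.
  by apply: leq_ltn_trans lt_jn; rewrite leq_pmulr // gcdn_gt0 q_an.
have n_gt0 : (0 < n)%N := leq_ltn_trans (leq0n j) j_n.
have le_n i : f`_i != 0 -> (i <= n)%N.
  by move=> fi; rewrite -ltnS -size_f ltnNge; apply: contra fi => /(nth_default 0) ->.
have f0 : f != 0 by rewrite -size_poly_gt0 size_f.
(* The single edge of the q-polygon, with its slope left unreduced; index 0 has weight 0. *)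
have q_first : np_first q n (padic_val q f`_n) f 0.
  split=> // i fi; rewrite /np_weight q_a0 !muln0 addr0 subr0.
  case: (posnP i) => [->|i0]; first by rewrite q_a0 !muln0 subr0.
  have := q_ai i; rewrite i0 le_n // => /(_ isT fi).
  rewrite ler_pdivrMr ?ltr0n // mulrAC ler_pdivlMr ?ltr0n // -!natrM ler_nat.
  lia.
have vjn : (padic_val p f`_j * n < padic_val p f`_n * j)%N.
  move: p_an; rewrite ltr_pdivrMr ?ltr0n // mulrAC ltr_pdivlMr ?ltr0n //.
  by rewrite -!natrM ltr_nat.
(* [m] and [u] are the width and the rise of the last edge of the p-polygon. *)
have [m def_n m_gt0] : exists2 m, n = (j + m)%N & (0 < m)%N.
  by exists (n - j)%N; lia.
have [u def_v] : exists u, padic_val p f`_n = (padic_val p f`_j + u)%N.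
  by exists (padic_val p f`_n - padic_val p f`_j)%N; nia.
have slopes : (padic_val p f`_j * m < u * j)%N by nia.
have coprime_mu : coprime m u.
  move: gcd_n; rewrite def_v def_n !PoszD !(addrAC _ _ (- _)) !subrr !add0r.
  by rewrite /coprime gcdnC /gcdz /= => -[->].
have p_weight i : np_weight p m u f i =
    (m * padic_val p f`_i)%N%:Z - (u * i)%N%:Z by [].
have p_weight_n : np_weight p m u f n = np_weight p m u f j.
  by rewrite !p_weight def_v def_n !mulnDr; lia.
have p_first : np_first p m u f j.
  split=> // i fi; rewrite !p_weight.
  case: (ltngtP i j) => [lt_ij|lt_ji|->]; last by rewrite addr0.
  - case: (posnP i) => [->|i0]; first by rewrite p_a0 !muln0; lia.
    have := p_below_j i; rewrite i0 lt_ij => /(_ isT fi).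
    rewrite ltr_pdivrMr ?ltr0n // mulrAC ltr_pdivlMr ?ltr0n //.
    rewrite -!natrM ltr_nat => vij.
    (* The point of index [i] lies above the chord from the origin to index [j], which lies above
       the leftward extension of the steeper last edge. *)
    suff: (m * padic_val p f`_j + u * i < m * padic_val p f`_i + u * j)%N by lia.
    rewrite -(ltn_pmul2l j_ge1); move: vij; rewrite -(ltn_pmul2l m_gt0).
    have := slopes; have ji_gt0 : (0 < j - i)%N by rewrite subn_gt0.
    rewrite -(ltn_pmul2l ji_gt0) !mulnBl.
    have := leq_mul (ltnW lt_ij) (ltnW slopes); lia.
  - have := le_n i fi; rewrite leq_eqVlt => /predU1P[->|lt_in].
      by rewrite def_v def_n !mulnDr; lia.
    have := p_above_j i; rewrite lt_ji lt_in => /(_ isT fi).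
    rewrite ![_ / _ * _]mulrAC -mulrDl -!natrB 1?ltnW //.
    rewrite ltr_pdivrMr ?ltr0n ?subn_gt0 // -!natrM -natrD ltr_nat def_v.
    (* Without truncated subtractions, the interpolation bound says that the point of index [i] lies
       above the last edge. *)
    have [k [l [-> -> -> def_i def_m]]] : exists k l,
        [/\ n - i = l, i - j = k, n - j = m, i = j + k & m = k + l]%N.
      by exists (i - j)%N, (n - i)%N; split; lia.
    move: (padic_val p f`_i) => v; rewrite def_i def_m !mulnDr !mulnDl; lia.
have small g h : f = g * h -> ((size g).-1 <= j)%N -> (size g).-1 = 0%N.
  move=> def_f le_gj.
  have := @np_edge_factor q n (padic_val q f`_n) g h 0 q_prime n_gt0.
  rewrite -def_f size_f => /(_ f0 q_first)[].
    by rewrite /np_weight q_a0 /= !muln0 mulnC subrr.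
  move=> s [t [/eqP]]; rewrite addn_eq0 => /andP[/eqP-> _] _; rewrite subn0.
  (* For the degree [d] of [g], [n] divides [d] times the valuation and [d * n], hence [d] times
     their gcd, which is below [n] as [d <= j]. *)
  move=> n_dvd _; have : (n %| (size g).-1 * gcdn (padic_val q f`_n) n)%N.
    by rewrite muln_gcdr dvdn_gcd mulnC n_dvd dvdn_mull.
  have [//|d_gt0] := posnP (size g).-1.
  have G_gt0 : (0 < gcdn (padic_val q f`_n) n)%N by rewrite gcdn_gt0 q_an.
  rewrite gtnNdvd ?muln_gt0 ?d_gt0 //.
  by apply: leq_ltn_trans lt_jn; rewrite leq_mul2r le_gj orbT.
split=> [|g0 g0_size g0_dvd]; first by rewrite size_rat_int_poly size_f ltnS.
have [g [a a0 def_g0] [h def_f]] := dvdpP_rat_int g0_dvd.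
have size_g : size g0 = size g by rewrite def_g0 size_scale ?size_rat_int_poly.
have /andP[gn0 hn0] : (g != 0) && (h != 0) by rewrite -negb_or -mulf_eq0 -def_f.
have size_gh : size f = (size g + (size h).-1)%N.
  by rewrite def_f size_mul // (polySpred hn0) addnS.
have := @np_edge_factor p m u g h j p_prime m_gt0.
rewrite -def_f size_f => /(_ f0 p_first p_weight_n)[s [t [st [le_s le_t]]]].
rewrite !Gauss_dvdr // => dvd_g dvd_h.
(* If the degree of [g] exceeds [s], it does so by at least [m]: then [g] takes up the whole edge
   and the degree of [h] is at most [t]. *)
have [g_le|g_gt] := leqP (size g).-1 s.
  have g_const : (size g).-1 = 0%N by apply: (small g h) => //; rewrite -st (leq_trans g_le) ?leq_addr.
  by move: g0_size; rewrite size_g (polySpred gn0) g_const.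
have h_le : ((size h).-1 <= t)%N.
  have deg_gh : ((size g).-1 + (size h).-1 = n)%N.
    by apply: succn_inj; rewrite -size_f size_gh -addSn -polySpred.
  rewrite -(leq_add2l (size g).-1) deg_gh def_n -st addnAC leq_add2r.
  by rewrite -leq_subRL // dvdn_leq // subn_gt0.
have h_const : (size h).-1 = 0%N.
  by apply: (small h g); rewrite 1?mulrC // -st (leq_trans h_le) ?leq_addl.
by rewrite -dvdp_size_eqp // size_g size_rat_int_poly size_gh h_const addn0.
Qed.
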